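(* For any nonnegative integer $N$ (and any nonnegative integer $n$) we have $$(-1)^{n}\sum_{j=-n}^{n}(-1)^{j}\,\mathrm{pod}\bigl(N-j(2j+1)\bigr)\geq 0.$$
   Context: For a nonnegative integer $m$, $\mathrm{pod}(m)$ denotes the number of partitions of $m$ without repeated odd parts (even parts may be repeated), so $\mathrm{pod}(0)=1$; by convention $\mathrm{pod}(m)=0$ for negative integers $m$. Its generating function is $\sum_{m=0}^{\infty}\mathrm{pod}(m)q^{m}=\prod_{i=0}^{\infty}\frac{1+q^{2i+1}}{1-q^{2i+2}}$ for $|q|<1$.
   Formalization: The inequality is proved for all nonnegative N and n except N = 0 with n odd, where it is false: only j = 0 contributes, so the left side equals (-1)^n pod(0) = -1. *)

(* Defs.v *)
From mathcomp Require Import all_boot all_order all_algebra.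

Set Implicit Arguments.
Unset Strict Implicit.
Unset Printing Implicit Defensive.

Local Open Scope nat_scope.

(* Multiplicity encoding of a partition of m: part i.+1 occurs f i times.
   No part and no multiplicity exceeds m, so the bounds lose nothing. *)
Definition is_partition (m : nat) (f : {ffun 'I_m -> 'I_m.+1}) : bool :=
  \sum_(i < m) f i * i.+1 == m.

Definition odd_parts_distinct (m : nat) (f : {ffun 'I_m -> 'I_m.+1}) : bool :=
  [forall i : 'I_m, odd i.+1 ==> (f i <= 1)].

Definition pod_nat (m : nat) : nat :=
  #|[set f : {ffun 'I_m -> 'I_m.+1} | is_partition f & odd_parts_distinct f]|.

(* Extended by 0 to negative integers. *)
Definition pod (m : int) : nat :=
  if m is Posz k then pod_nat k else 0.

(* Main.v *)
Require Import Defs.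
From mathcomp Require Import all_boot all_order all_algebra.
From mathcomp Require Import zify ring.
Import Order.TTheory GRing.Theory Num.Theory.
Local Open Scope ring_scope.

(** Write [P(q)] for the generating function of pod.  Two facts suffice.

    Monotonicity: [(1 + q) / (1 - q^2) = 1 / (1 - q)] is a factor of [P(q)],
    so [(1 - q) P(q)] is a product of series with nonnegative coefficients
    and pod is nondecreasing ([pod_nat_leS]).

    Gauss's identity: the series [sum_j (-1)^j q^(j(2j+1))], over all integers
    j, is the inverse of [P(q)].  Hence for N > 0 the sum over all j of
    [(-1)^j pod(N - j(2j+1))] vanishes ([gauss_recurrence]).

    By the second fact the sum over |j| <= n is minus the sum over |j| > n.
    Grouping j = -(m+1) with j = m+1, whose exponents are the consecutive
    triangular numbers (m+1)(2m+1) and (m+1)(2m+3), turns this tail into an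
    alternating sum over m >= n.  By the first fact its terms do not increase
    in absolute value, so the tail is zero or has the sign of its first term,
    (-1)^(n+1) ([alternating_sum_bounds]).

    Gauss's identity is obtained from the polynomial identity behind Shanks's
    proof ([shanks_identity]): the partial sum of the theta series over
    |j| <= n, times the first n factors [1 + q^(2i+1)], equals the product of
    the first n factors [1 - q^(2i+2)] up to terms of degree at least 2n+1.
    Power series are represented by polynomials of which only the coefficients
    below a bound matter ([eq_upto]). *)

(** * A finite form of Gauss's triangular number identity *)

Section GaussFinite.

Variables (R : comPzRingType) (x : R).

Definition odd_prod s : R := \prod_(i < s) (1 - x ^+ i.*2.+1).
Definition even_prod s n : R := \prod_(s <= i < n) (1 - x ^+ i.*2.+2).
(** The sum of [x^(k(k+1)/2)] over k <= 2n.  At [x = -q] it is the sum of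
    [(-1)^j q^(j(2j+1))] over |j| <= n: the signs (-1)^j come from the parity
    of the triangular numbers. *)
Definition gauss_sum n : R :=
  1 + \sum_(m < n) (x ^+ (m.+1 * m.*2.+1) + x ^+ (m.+1 * m.*2.+3)).

Definition shanks_term n s : R :=
  odd_prod s * even_prod s n * x ^+ (s * n.*2.+1).

(** The factor after [shanks_term n s] makes the summand equal to
    [shanks_term n.+1 s] minus [1 - x ^+ n.*2.+1] times [shanks_term n s],
    where [1 - x ^+ n.*2.+1] is the factor that [odd_prod] gains from n to
    n.+1.  The sum telescopes: the right-hand side for k = s, minus the one
    for k = s - 1 when s > 0, is the s-th summand. *)
Lemma shanks_telescope n k : (k <= n)%N ->
  \sum_(s < k.+1) shanks_term n s *
     ((1 - x ^+ n.*2.+2) * x ^+ s.*2 - (1 - x ^+ n.*2.+1)) =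
  odd_prod k.+1 * even_prod k n * x ^+ (k.+1 * n.*2.+1).
Proof.
elim: k => [|k IHk] lekn.
  rewrite big_ord_recl big_ord0 /shanks_term /odd_prod big_ord_recl !big_ord0.
  rewrite mul0n mul1n /= expr0 (exprS x n.*2.+1).
  by ring.
rewrite big_ord_recr /= IHk; last exact: ltnW.
rewrite /shanks_term.
have -> : odd_prod k.+2 = odd_prod k.+1 * (1 - x ^+ k.+1.*2.+1).
  by rewrite /odd_prod [LHS]big_ord_recr.
have -> : even_prod k n = (1 - x ^+ k.+1.*2) * even_prod k.+1 n.
  by rewrite /even_prod big_ltn ?doubleS.
rewrite (_ : k.+2 * n.*2.+1 = k.+1 * n.*2.+1 + n.*2.+1)%N; last lia.
rewrite exprD (exprS x k.+1.*2) (exprS x n.*2.+1).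
by ring.
Qed.

(** Passing from n to n.+1 adds two theta terms on the left.  On the right,
    the new term s = n.+1 accounts for the higher one, and [shanks_telescope]
    at k = n sums the changes in the terms s <= n to the lower one. *)
Lemma shanks_identity n :
  odd_prod n * gauss_sum n = \sum_(s < n.+1) shanks_term n s.
Proof.
elim: n => [|n IHn].
  rewrite /gauss_sum big_ord0 big_ord_recl big_ord0 /shanks_term /even_prod.
  by rewrite big_nil mul0n expr0 !addr0 !mulr1.
have oddS : odd_prod n.+1 = odd_prod n * (1 - x ^+ n.*2.+1).
  by rewrite /odd_prod big_ord_recr.
have -> : gauss_sum n.+1 = gauss_sum n
    + (x ^+ (n.+1 * n.*2.+1) + x ^+ (n.+1 * n.*2.+3)).
  by rewrite /gauss_sum big_ord_recr addrA.
rewrite mulrDr {1}oddS mulrAC IHn [in RHS]big_ord_recr /=.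
have -> : shanks_term n.+1 n.+1 = odd_prod n.+1 * x ^+ (n.+1 * n.*2.+3).
  by rewrite /shanks_term /even_prod big_geq // mulr1 doubleS.
rewrite [odd_prod n.+1 * _]mulrDr addrA; congr (_ + _).
have := shanks_telescope n n (leqnn n).
rewrite /even_prod big_geq // mulr1 => <-.
rewrite mulr_suml -big_split /=; apply: eq_bigr => s _.
have les : (s <= n)%N by rewrite -ltnS.
have -> : shanks_term n.+1 s =
    shanks_term n s * (1 - x ^+ n.*2.+2) * x ^+ s.*2.
  rewrite /shanks_term /even_prod big_nat_recr //=.
  rewrite (_ : s * n.+1.*2.+1 = s * n.*2.+1 + s.*2)%N; last lia.
  by rewrite exprD; ring.
by ring.
Qed.

End GaussFinite.

Arguments odd_prod {R}.
Arguments even_prod {R}.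
Arguments gauss_sum {R}.
Arguments shanks_term {R}.

(** * Congruence of polynomials modulo a power of the variable *)

Definition eq_upto d (p q : {poly int}) := forall k, (k < d)%N -> p`_k = q`_k.

Lemma eq_upto_trans d p q r : eq_upto d p q -> eq_upto d q r -> eq_upto d p r.
Proof. by move=> pq qr k ltkd; rewrite pq ?qr. Qed.

Lemma eq_uptoM d p1 q1 p2 q2 :
  eq_upto d p1 q1 -> eq_upto d p2 q2 -> eq_upto d (p1 * p2) (q1 * q2).
Proof.
move=> e1 e2 k ltkd; rewrite !coefM; apply: eq_bigr => i _.
by rewrite e1 ?e2 //; have := ltn_ord i; lia.
Qed.

Lemma eq_upto_prod d (I : Type) (r : seq I) (P : pred I) (F G : I -> {poly int}) :
  (forall i, P i -> eq_upto d (F i) (G i)) ->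
  eq_upto d (\prod_(i <- r | P i) F i) (\prod_(i <- r | P i) G i).
Proof.
by move=> FG; elim/big_rec2: _ => // i p q Pi pq; apply: eq_uptoM => //; apply: FG.
Qed.

Lemma eq_uptoDXn d p q e : (d <= e)%N -> eq_upto d (p + 'X^e * q) p.
Proof. by move=> lede k ltkd; rewrite coefD coefXnM (leq_trans ltkd lede) addr0. Qed.

(** * The generating polynomial of pod *)

(** The factor of the generating function due to the part i.+1, with
    multiplicities below d so that it is a polynomial. *)
Definition part_poly d i : {poly int} :=
  \sum_(0 <= a < d | odd i.+1 ==> (a <= 1)%N) 'X^(a * i.+1).

Lemma coef_prod_part_poly K B m :
  (\prod_(i < K) part_poly B.+1 i)`_m =
  #|[set f : {ffun 'I_K -> 'I_B.+1} | (\sum_(i < K) f i * i.+1 == m)%N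
       & [forall i : 'I_K, odd i.+1 ==> (f i <= 1)%N]]|%:R.
Proof.
under eq_bigr => i _ do rewrite /part_poly big_mkord.
rewrite bigA_distr_big_dep /= coef_sum -sum1_card natr_sum.
rewrite big_mkcond [RHS]big_mkcond /=; apply: eq_bigr => f _.
rewrite -expr_sum coefXn eq_sym [in RHS]inE.
have -> : (f \in family (fun i : 'I_K =>
     [pred a : 'I_B.+1 | odd i.+1 ==> (a <= 1)%N])) =
   [forall i : 'I_K, odd i.+1 ==> (f i <= 1)%N] by [].
by case: (_ == m) => /=; case: ifP.
Qed.

Lemma part_poly_widen d d' i : (d <= d')%N ->
  eq_upto d (part_poly d' i) (part_poly d i).
Proof.
move=> led k ltkd; rewrite /part_poly (big_cat_nat (leq0n d) led) //= coefD.
rewrite [X in _ + X]coef_sum [X in _ + X]big_nat_cond.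
rewrite [X in _ + X]big1 ?addr0 // => a /andP[/andP[leda _] _].
by rewrite coefXn (_ : (k == _) = false) //; apply/eqP; nia.
Qed.

Lemma part_poly_large d i : (0 < d)%N -> eq_upto (minn d i.+1) (part_poly d i) 1.
Proof.
move=> d0 k; rewrite leq_min => /andP[ltkd ltki].
rewrite /part_poly big_mkcond big_ltn //= implybT mul0n expr0 coefD.
rewrite coef_sum big_nat_cond big1 ?addr0 // => a /andP[/andP[lt0a _] _].
case: ifP; rewrite ?coef0 // => _.
by rewrite coefXn (_ : (k == _) = false) //; apply/eqP; nia.
Qed.

(** The encoding of a partition of m caps parts and multiplicities at m.
    Raising these caps only affects degrees above m, so one product serves
    for all the values of pod below a fixed bound. *)
Lemma coef_pod d K m : (m < d)%N -> (m <= K)%N ->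
  (\prod_(0 <= i < K) part_poly d i)`_m = (pod_nat m)%:R.
Proof.
move=> ltmd lemK; rewrite /pod_nat -coef_prod_part_poly.
rewrite -(big_mkord xpredT (part_poly m.+1)).
suff: eq_upto m.+1 (\prod_(0 <= i < K) part_poly d i)
                   ((\prod_(0 <= i < m) part_poly m.+1 i) * 1).
  by rewrite mulr1 => ->.
rewrite (big_cat_nat (leq0n m) lemK) //=; apply: eq_uptoM.
  by apply: eq_upto_prod => i _; apply: part_poly_widen.
apply: (@eq_upto_trans _ _ (\prod_(m <= i < K) 1)); last by rewrite big1_eq.
rewrite big_nat_cond [X in eq_upto _ _ X]big_nat_cond.
apply: eq_upto_prod => i /andP[/andP[lemi _] _] k ltkm.
by apply: part_poly_large; lia.
Qed.

(** The geometric series of ratio ['X^e], cut so that it inverts [1 - 'X^e]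
    up to degree d. *)
Definition geom d e : {poly int} := \sum_(a < d) 'X^e ^+ a.

Lemma geomK d e : (0 < e)%N -> eq_upto d ((1 - 'X^e) * geom d e) 1.
Proof.
move=> e0; have -> : (1 - 'X^e) * geom d e = 1 + 'X^(e * d) * (- 1) :> {poly int}.
  rewrite exprM; have := subrX1 ('X^e : {poly int}) d; rewrite -/(geom d e) => E.
  by rewrite -[1 - _]opprB mulNr -E; ring.
by apply: eq_uptoDXn; nia.
Qed.

(** Equality is exact because the bound d.+2 leaves room for the
    multiplicities 0 and 1 of an odd part. *)
Lemma prod_part_polyE d n :
  \prod_(0 <= i < n.*2) part_poly d.+2 i =
  \prod_(j < n) ((1 + 'X^(j.*2.+1)) * geom d.+2 j.*2.+2).
Proof.
elim: n => [|n IHn]; first by rewrite big_nil big_ord0.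
rewrite doubleS !big_nat_recr //= IHn big_ord_recr /= -mulrA.
congr (_ * (_ * _)).
  rewrite /part_poly big_mkord !big_mkcond /= odd_double /= !big_ord_recl /=.
  by rewrite mul0n mul1n expr0 big1 ?addr0.
rewrite /part_poly big_mkord /geom /= odd_double /=.
by apply: eq_bigr => a _; rewrite mulnC exprM.
Qed.

(** * Monotonicity of pod *)

Definition coefs_ge0 (p : {poly int}) := forall k, 0 <= p`_k.

Lemma coefs_ge0_Xn n : coefs_ge0 'X^n.
Proof. by move=> k; rewrite coefXn; case: eqP. Qed.

Lemma coefs_ge0D p q : coefs_ge0 p -> coefs_ge0 q -> coefs_ge0 (p + q).
Proof. by move=> p0 q0 k; rewrite coefD addr_ge0. Qed.

Lemma coefs_ge0M p q : coefs_ge0 p -> coefs_ge0 q -> coefs_ge0 (p * q).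
Proof. by move=> p0 q0 k; rewrite coefM sumr_ge0 // => i _; apply: mulr_ge0. Qed.

(** For the parts 1 and 2 together, [(1 - 'X) * (1 + 'X)] cancels the
    geometric series of the part 2; the other parts contribute the product
    [T], whose coefficients are nonnegative. *)
Lemma pod_nat_leS m : (pod_nat m <= pod_nat m.+1)%N.
Proof.
pose G := \prod_(0 <= i < m.+1.*2) part_poly m.+2 i.
have Gm : G`_m = (pod_nat m)%:R by apply: coef_pod; lia.
have GmS : G`_m.+1 = (pod_nat m.+1)%:R by apply: coef_pod; lia.
pose T := \prod_(j < m) ((1 + 'X^(j.+1.*2.+1)) * geom m.+2 j.+1.*2.+2).
have Tnneg : coefs_ge0 T.
  rewrite /T; elim/big_ind: _ => [|p q p0 q0|j _].
  - exact: coefs_ge0_Xn 0.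
  - exact: coefs_ge0M.
  apply: coefs_ge0M.
    by apply: coefs_ge0D; [exact: coefs_ge0_Xn 0 | exact: coefs_ge0_Xn].
  rewrite /geom; elim/big_ind: _ => [k|p q p0 q0|a _].
  - by rewrite coef0.
  - exact: coefs_ge0D.
  by rewrite -exprM; apply: coefs_ge0_Xn.
have : eq_upto m.+2 ((1 - 'X) * G) (1 * T).
  rewrite /G prod_part_polyE big_ord_recl /= mulrA; apply: eq_uptoM => //.
  by rewrite expr1 mulrA (_ : (1 - 'X) * (1 + 'X) = 1 - 'X^2);
    [apply: geomK | ring].
move=> /(_ m.+1 (ltnSn _)); rewrite mul1r mulrBl mul1r coefB coefXM /= Gm GmS.
by have T0 := Tnneg m.+1 => E; rewrite -E in T0; lia.
Qed.

Lemma pod_nat_mono : {homo pod_nat : m n / (m <= n)%N}.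
Proof. exact: homo_leq leqnn leq_trans pod_nat_leS. Qed.

(** * The recurrence for pod *)

Definition podz (N e : nat) : int := (pod (N%:Z - e%:Z))%:Z.

Lemma podzE N e : podz N e = if (e <= N)%N then (pod_nat (N - e))%:Z else 0.
Proof.
rewrite /podz; case: leqP => [leeN | ltNe]; first by rewrite subzn.
by have [k ->] : exists k, N%:Z - e%:Z = Negz k by exists (e - N).-1; lia.
Qed.

Lemma podz_anti N e e' : (e <= e')%N -> podz N e' <= podz N e.
Proof.
move=> le_e; rewrite !podzE; case: leqP => [le'|_]; last by case: ifP.
by rewrite (leq_trans le_e le') lez_nat; apply: pod_nat_mono; lia.
Qed.

(** The values at j = -(m+1) and j = m+1, which carry the same sign. *)
Definition theta_pair N m : int :=
  podz N (m.+1 * m.*2.+1) + podz N (m.+1 * m.*2.+3).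

(** With n >= N the partial sum contains every nonzero term.  The recurrence
    is then the coefficient of degree N in [gauss_sum X' n * G], a product
    that [shanks_identity] at [X' = - 'X] shows to be 1 up to degree N. *)
Lemma gauss_recurrence N n : (0 < N)%N -> (N <= n)%N ->
  podz N 0 + \sum_(m < n) (-1) ^+ m.+1 * theta_pair N m = 0.
Proof.
move=> N0 leNn.
pose G := \prod_(0 <= i < n.*2) part_poly N.+2 i.
pose X' : {poly int} := - 'X.
have expXN e : X' ^+ e = (-1) ^+ e *: 'X^e.
  by rewrite /X' -scaleN1r exprZn.
have coefG e : (X' ^+ e * G)`_N = (-1) ^+ e * podz N e.
  rewrite expXN -scalerAl coefZ coefXnM podzE; case: leqP => // leeN.
  by rewrite coef_pod //; lia.
have SG : eq_upto N.+1 (gauss_sum X' n * G) 1.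
  pose H := \prod_(j < n) geom N.+2 j.*2.+2.
  have GE : G = odd_prod X' n * H.
    rewrite /G prod_part_polyE big_split /=; congr (_ * _).
    apply: eq_bigr => j _; rewrite expXN -signr_odd /= odd_double.
    by rewrite scaleN1r opprK.
  have -> : gauss_sum X' n * G = (\sum_(s < n.+1) shanks_term X' n s) * H.
    by rewrite -shanks_identity GE; ring.
  apply: (@eq_upto_trans _ _ (even_prod X' 0 n * H)); last first.
    apply: (@eq_upto_trans _ _ (\prod_(j < n) 1)); last by rewrite big1_eq.
    rewrite /even_prod big_mkord -big_split /=.
    apply: eq_upto_prod => j _ k ltk; rewrite expXN -signr_odd /= odd_double.
    by rewrite scale1r; apply: (@geomK N.+2) => //; lia.
  apply: eq_uptoM => //.
  (* The terms s > 0 are multiples of 'X^(2n + 1), and 2n + 1 > N. *)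
  rewrite big_ord_recl {1}/shanks_term /odd_prod big_ord0 mul0n expr0 mulr1 mul1r.
  move=> k ltk; rewrite coefD coef_sum big1 ?addr0 // => s _.
  rewrite /shanks_term expXN -scalerAr coefZ mulrC coefMXn.
  by rewrite (_ : (k < _)%N) ?mul0r //= /bump; nia.
have := SG N (ltnSn _); rewrite coef1 gtn_eqF //= => SGN.
apply: etrans SGN.
rewrite /gauss_sum mulrDl mul1r coefD mulr_suml coef_sum; congr (_ + _).
  by have := coefG 0%N; rewrite !expr0 !mul1r => <-.
apply: eq_bigr => m _; rewrite mulrDl coefD !coefG /theta_pair mulrDr.
by congr (_ * _ + _ * _); rewrite -signr_odd -[RHS]signr_odd oddM /=
  ?negbK odd_double andbT.
Qed.

(** * Truncation *)

(** The upper bound is what carries the induction: the sum is [u 0] minus the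
    sum for the shifted sequence, which is at most [u 1]. *)
Lemma alternating_sum_bounds (u : nat -> int) n :
  (forall m, 0 <= u m) -> (forall m, u m.+1 <= u m) ->
  0 <= \sum_(i < n) (-1) ^+ i * u i <= u 0%N.
Proof.
elim: n u => [|n IHn] u u0 uS; first by rewrite big_ord0 u0 andbT.
rewrite big_ord_recl /= expr0 mul1r.
under eq_bigr => i _ do rewrite /bump /= add1n exprS -mulrA mulN1r.
rewrite sumrN; have := IHn (u \o S) (fun m => u0 m.+1) (fun m => uS m.+1).
move=> /= /andP[tail0 tail1]; rewrite lerBlDr lerDl tail0 subr_ge0 andbT.
exact: le_trans tail1 (uS 0%N).
Qed.

Lemma symmetric_sumE N n :
  \sum_(i < n.*2.+1) (let j : int := i%:Z - n%:Z in
     (-1) ^ j * (pod (N%:Z - j * (2 * j + 1)))%:Z) =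
  podz N 0 + \sum_(m < n) (-1) ^+ m.+1 * theta_pair N m :> int.
Proof.
elim: n => [|n IHn].
  by rewrite big_ord_recl !big_ord0 /= subrr expr0z mul1r /podz subr0 addn0.
rewrite [in RHS]big_ord_recr /= addrA -IHn doubleS.
rewrite big_ord_recr big_ord_recl /= /theta_pair.
set A := \sum_(i < _) _; set B := \sum_(i < _) _.
have -> : A = B.
  apply: eq_bigr => i _; rewrite /bump /=.
  by have -> : (1 + i)%N%:Z - n.+1%:Z = i%:Z - n%:Z by lia.
have -> : 0 - n.+1%:Z = - n.+1%:Z by lia.
have -> : n.*2.+2%:Z - n.+1%:Z = n.+1%:Z by lia.
rewrite -exprnN -exprVn invrN1 -exprnP /podz.
have -> : N%:Z - - n.+1%:Z * (2 * - n.+1%:Z + 1) = N%:Z - (n.+1 * n.*2.+1)%N%:Z.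
  by lia.
have -> : N%:Z - n.+1%:Z * (2 * n.+1%:Z + 1) = N%:Z - (n.+1 * n.*2.+3)%N%:Z.
  by lia.
by ring.
Qed.

(* The range -n <= j <= n is reindexed by j = i - n with 0 <= i <= 2n.
   For N = 0 the sum is pod 0 = 1 whatever n is, so the inequality fails when
   N = 0 and n is odd; hNn excludes exactly these pairs. *)
Theorem theorem1p4 (N n : nat) (hNn : (0 < N)%N || ~~ odd n) :
  0 <= (-1) ^+ n *
       \sum_(i < n.*2.+1)
          (let j : int := i%:Z - n%:Z in
           (-1) ^ j * (pod (N%:Z - j * (2 * j + 1)))%:Z) :> int.
Proof.
rewrite symmetric_sumE; case: N hNn => [/= n_even | N _].
  rewrite -signr_odd (negbTE n_even) mul1r big1 ?addr0 // => m _.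
  by rewrite /theta_pair !podzE addr0 mulr0.
(* The complete sum stops after n + N + 1 pairs, where gauss_recurrence
   applies; head is minus its last N + 1 pairs. *)
set head := (X in _ * X).
have -> : head = (-1) ^+ n *
    \sum_(i < N.+1) (-1) ^+ i * theta_pair N.+1 (n + i).
  have := gauss_recurrence _ _ (ltn0Sn N) (leq_addl n N.+1).
  rewrite big_split_ord /= addrA -/head => /eqP; rewrite addr_eq0 => /eqP ->.
  rewrite -sumrN mulr_sumr; apply: eq_bigr => i _.
  by rewrite -mulNr exprS mulN1r opprK exprD mulrA.
rewrite mulrA -expr2 sqrr_sign mul1r.
have u_ge0 m : 0 <= theta_pair N.+1 (n + m) by rewrite /theta_pair /podz.
have u_anti m : theta_pair N.+1 (n + m.+1) <= theta_pair N.+1 (n + m).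
  by rewrite /theta_pair; apply: lerD; apply: podz_anti; nia.
by have /andP[] := alternating_sum_bounds _ N.+1 u_ge0 u_anti.
Qed.
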